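(* Let $q=ip$ with $p>1$ real. (a) If $|q|=\sqrt{\frac{1+\sqrt5}{2}}$, then the set of expansions of $x=0$ in base $q$ is countably infinite. (b) If $|q|<\sqrt{\frac{1+\sqrt5}{2}}$, then each point of $J_q$ except the four complex numbers $a+ib$ with $a\in\left\{\frac{-p^2}{p^4-1},\frac{1}{p^4-1}\right\}$ and $b\in\left\{\frac{-p^3}{p^4-1},\frac{p}{p^4-1}\right\}$ has continuum many expansions in base $q$.
   Context: For a complex number $q$ with $|q|>1$, an expansion of a complex number $x$ in base $q$ is a sequence $(c_k)_{k\ge1}$ with $c_k\in\{0,1\}$ such that $\sum_{k=1}^\infty c_k q^{-k}=x$. $J_q$ denotes the set of all complex numbers having at least one expansion in base $q$. (For $q=ip$, $J_q$ is contained in the rectangle $\left[\frac{-p^2}{p^4-1},\frac{1}{p^4-1}\right]\times\left[\frac{-p^3}{p^4-1},\frac{p}{p^4-1}\right]$ of $\mathbb C\cong\mathbb R^2$, and the four excluded points are its vertices.) *)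

(* Defs.v *)
From HB Require Import structures.
From mathcomp Require Export all_boot all_order all_algebra.
From mathcomp Require Export complex.
From mathcomp Require Export all_classical all_reals all_analysis.
Export Order.TTheory GRing.Theory Num.Theory numFieldNormedType.Exports.

Set Implicit Arguments.
Unset Strict Implicit.
Unset Printing Implicit Defensive.

Local Open Scope ring_scope.
Local Open Scope classical_set_scope.
Local Open Scope complex_scope.

(* Digit sequences are indexed from 0: [c k] stands for the digit c_(k+1).
   The topology of the numFieldType R[i] is carried by its alias R[i]^o. *)
Definition expansions (R : realType) (q x : R[i]) : set (nat -> bool) :=
  [set c | series (fun k => (c k)%:R / q ^+ k.+1 : R[i]^o) @ \oo --> (x : R[i]^o)].

Definition J (R : realType) (q : R[i]) : set R[i] :=
  [set x | exists c, expansions q x c].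

Definition vertices (R : realType) (p : R) : set R[i] :=
  [set a +i* b | a in [set - p ^+ 2 / (p ^+ 4 - 1); 1 / (p ^+ 4 - 1)]
               & b in [set - p ^+ 3 / (p ^+ 4 - 1); p / (p ^+ 4 - 1)]].

(* Main.v *)
(** With [q = i p] and [b = p^2], the digits of odd and even index of an
    expansion in base [q] are independent expansions, in base [-b], of the real
    part and of the imaginary part divided by [p]. Flipping every other digit
    turns these into expansions in base [b] of the points shifted by
    [b / (b^2 - 1)], so the expansions of [x] form a product of two sets of
    expansions in a real base. An expansion is recognised by the boundedness of
    its remainders [r_0 = y], [r_(n+1) = b r_n - d_n].
    For [x = 0] and the golden base [b], both shifted points equal [1]; a
    remainder of [1] alternates between [1] and [b - 1] until it falls on an
    endpoint of [[0, 1/(b-1)]], where all further digits are forced.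
    For smaller [b], every remainder orbit in the interior passes infinitely
    often through the region where either digit may be chosen, and these choices
    embed the Cantor space into the set of expansions. *)

Require Import Defs.
From mathcomp Require Import ring lra.

Set Implicit Arguments.
Unset Strict Implicit.
Unset Printing Implicit Defensive.

Local Open Scope ring_scope.
Local Open Scope classical_set_scope.
Local Open Scope card_scope.
Local Open Scope complex_scope.

(** * Remainder orbits and their range *)

Fixpoint remainder (K : pzRingType) (b x : K) (d : nat -> bool) (n : nat) : K :=
  if n is m.+1 then b * remainder b x d m - (d m)%:R else x.

Lemma remainderS (K : pzRingType) (b x : K) (d : nat -> bool) (n : nat) :
  remainder b x d n.+1 = b * remainder b x d n - (d n)%:R.
Proof. by []. Qed.

(* For `|b| > 1 these are the expansions of [x] in base [b]: the n-th remainder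
   is b^n times the difference between [x] and the n-th partial sum. *)
Definition bounded_expansions (K : numDomainType) (b x : K) : set (nat -> bool) :=
  [set d | exists C, forall n, `|remainder b x d n| <= C].

Lemma exprn_unbounded (R : realType) (b C : R) : 1 < b -> exists n, C < b ^+ n.
Proof.
move=> b1.
have bern n : 1 + (b - 1) * n%:R <= b ^+ n.
  elim: n => [|n IHn]; first by rewrite mulr0 addr0 expr0.
  rewrite exprS -natr1.
  have n0 : (0 : R) <= n%:R := ler0n _ _.
  have : b * (1 + (b - 1) * n%:R) <= b * b ^+ n by rewrite ler_wpM2l//; lra.
  have := mulr_ge0 (sqr_ge0 (b - 1)) n0; nra.
exists (Num.Def.archi_bound (`|C| / (b - 1))).
have b10 : 0 < b - 1 by lra.
have := archi_boundP (divr_ge0 (normr_ge0 C) (ltW b10)).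
rewrite ltr_pdivrMr// mulrC => h.
by have := bern (Num.Def.archi_bound (`|C| / (b - 1))); have := ler_norm C; lra.
Qed.

Section real_base.
Context {R : realType}.
Implicit Types (b y : R) (d s : nat -> bool).

Lemma remainderD b y d m n :
  remainder b y d (m + n) = remainder b (remainder b y d m) (fun k => d (m + k)%N) n.
Proof. by elim: n => [|n IHn]; rewrite ?addn0// addnS /= IHn. Qed.

(** Digit 1 fixes [1/(b-1)] as digit 0 fixes 0, so complementing all digits mirrors the orbit; upper
    bounds on remainders then follow from lower ones. *)
Lemma remainder_negb b y d n : b != 1 ->
  remainder b ((b - 1)^-1 - y) (fun k => ~~ d k) n = (b - 1)^-1 - remainder b y d n.
Proof.
move=> b1; have b10 : b - 1 != 0 by rewrite subr_eq0.
elim: n => [//|n /= ->].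
by case: (d n) => /=; field.
Qed.

(** Digits only decrease remainders, so a negative [y] would force the n-th one to be at most
    [b^n y], which is unbounded below. *)
Lemma bounded_expansions_ge0 b y d :
  1 < b -> bounded_expansions b y d -> 0 <= y.
Proof.
move=> b1 [C hC]; rewrite leNgt; apply/negP => y0.
have le_rem n : remainder b y d n <= b ^+ n * y.
  elim: n => [|n IHn] /=; first by rewrite expr0 mul1r.
  rewrite exprS -mulrA lerBlDr (le_trans (ler_wpM2l _ IHn))//; first lra.
  by rewrite lerDl ler0n.
have [n hn] := exprn_unbounded (C / - y) b1.
have := hC n; have := le_rem n; move: hn; rewrite ltr_pdivrMr; last lra.
by have := ler_norm (- remainder b y d n); rewrite normrN; lra.
Qed.

Lemma bounded_expansions_itv b y d :
  1 < b -> bounded_expansions b y d -> 0 <= y <= (b - 1)^-1.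
Proof.
move=> b1 hd; rewrite (bounded_expansions_ge0 b1 hd)/= -subr_ge0.
apply: (@bounded_expansions_ge0 _ _ (fun k => ~~ d k) b1).
have [C hC] := hd; exists (`|(b - 1)^-1| + C) => n.
rewrite remainder_negb ?gt_eqF//.
by rewrite (le_trans (ler_normB _ _))// lerD2l.
Qed.

Lemma bounded_expansions_remainder b y d m :
  1 < b -> bounded_expansions b y d -> 0 <= remainder b y d m <= (b - 1)^-1.
Proof.
move=> b1 [C hC]; apply: (@bounded_expansions_itv _ _ (fun k => d (m + k)%N)) => //.
by exists C => n; rewrite -remainderD.
Qed.

(** * Countably many expansions of 1 in the golden base *)

(* [None] is the periodic expansion 101010...; [Some n] departs from it at [n],
   where the remainder becomes 0 or 1/(b-1) and forces all later digits. *)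
Definition golden_expansion (o : option nat) (k : nat) : bool :=
  if o is Some n then
    if (k < n)%N then ~~ odd k else if k == n then odd n else ~~ odd n
  else ~~ odd k.

Lemma golden_expansion_inj : injective golden_expansion.
Proof.
have lt_neq n m : (n < m)%N -> golden_expansion (Some n) <> golden_expansion (Some m).
  move=> nm /(congr1 (@^~ n)); rewrite /golden_expansion ltnn eqxx nm.
  by case: (odd n).
have neq_None n : golden_expansion (Some n) <> golden_expansion None.
  move=> /(congr1 (@^~ n)); rewrite /golden_expansion ltnn eqxx.
  by case: (odd n).
move=> [n|] [m|] // => [h|/neq_None//|/esym/neq_None//].
by have [/lt_neq/(_ h)|/lt_neq/(_ (esym h))|->] := ltngtP n m.
Qed.

Lemma remainder_alternating b d n : b ^+ 2 = b + 1 ->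
  (forall k, (k < n)%N -> d k = ~~ odd k) ->
  remainder b 1 d n = if odd n then b - 1 else 1.
Proof.
move=> hb; elim: n => [//|n IHn] hd /=.
rewrite IHn; last by move=> k kn; apply: hd; rewrite ltnS ltnW.
rewrite hd//; case: (odd n) => /=; last by rewrite mulr1.
by rewrite subr0 mulrBr mulr1 -expr2 hb; ring.
Qed.

Lemma golden_expansion_remainder b n k : b ^+ 2 = b + 1 ->
  remainder b 1 (golden_expansion (Some n)) (n.+1 + k) = if odd n then 0 else b.
Proof.
move=> hb; elim: k => [|k IHk].
  rewrite addn0 /= (remainder_alternating hb); last first.
    by move=> k kn; rewrite /golden_expansion kn.
  rewrite /golden_expansion ltnn eqxx; case: (odd n) => /=; last by rewrite mulr1 subr0.
  by move: hb; rewrite expr2 => hb; lra.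
rewrite addnS remainderS IHk.
have -> : golden_expansion (Some n) (n.+1 + k) = ~~ odd n.
  by rewrite /golden_expansion ltnNge ltnW ?gtn_eqF// addSn ltnS leq_addr.
case: (odd n) => /=; first by rewrite mulr0 subr0.
by rewrite -expr2 hb addrK.
Qed.

Lemma bounded_expansions_golden b : 1 < b -> b ^+ 2 = b + 1 ->
  bounded_expansions b 1 = range golden_expansion.
Proof.
move=> b1 hb; apply/seteqP; split => d.
  move=> hd.
  have [alt|/existsNP dev] := pselect (forall n, d n = ~~ odd n).
    by exists None => //; apply/funext => k; rewrite alt.
  have {}dev : exists n, d n == odd n.
    by have [n dn] := dev; exists n; move: dn; case: (d n) (odd n) => [] [].
  case: (ex_minnP dev) => n /eqP dn nmin.
  have alt k : (k < n)%N -> d k = ~~ odd k.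
    move=> kn; have : d k != odd k by apply/eqP => /eqP/nmin; rewrite leqNgt kn.
    by case: (d k) (odd k) => [] [].
  have remS : remainder b 1 d n.+1 = if odd n then 0 else b.
    rewrite /= (remainder_alternating hb alt) dn; move: hb; rewrite expr2.
    by case: (odd n) => /=; lra.
  have forced k : remainder b 1 d (n.+1 + k) = (if odd n then 0 else b) /\
      d (n.+1 + k)%N = ~~ odd n.
    (* The other digit would send 0 to -1, or [b] to [b^2 = b + 1], outside [[0, b]]. *)
    have digit m : remainder b 1 d m = (if odd n then 0 else b) -> d m = ~~ odd n.
      move=> hm; have := bounded_expansions_remainder m.+1 b1 hd.
      have -> : (b - 1)^-1 = b.
        apply: (mulfI (_ : b - 1 != 0)); first by rewrite gt_eqF//; lra.
        by rewrite divff ?gt_eqF//; [move: hb; rewrite expr2; lra|lra].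
      rewrite /= hm; case: (odd n) (d m) => [] []//=; move: hb; rewrite expr2; lra.
    elim: k => [|k [IHk IHd]]; first by rewrite addn0; split => //; exact: digit.
    suff h : remainder b 1 d (n.+1 + k.+1) = if odd n then 0 else b.
      by split => //; exact: digit.
    rewrite addnS remainderS IHk IHd.
    by move: hb; rewrite expr2; case: (odd n) => /=; lra.
  exists (Some n) => //; apply/funext => k; rewrite /golden_expansion.
  case: ltngtP => [/alt//|nk|->//].
  by have [_] := forced (k - n.+1)%N; rewrite subnKC.
(* The remainders of these sequences take only the values 0, 1, [b - 1] and [b]. *)
move=> [r _ <-]; exists b => k.
have le1 j : `|if odd j then b - 1 else 1| <= b.
  by case: (odd j); rewrite ger0_norm; lra.
case: r => [n|]; last by rewrite (remainder_alternating hb).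
have [kn|nk] := leqP k n.
  rewrite (remainder_alternating hb)// => j jk.
  by rewrite /golden_expansion (leq_trans jk kn).
rewrite -(subnKC nk) (golden_expansion_remainder _ _ hb).
by case: (odd n); rewrite ger0_norm; lra.
Qed.

(** * Continuum many expansions below the golden base *)

(* The remainders at which both digits keep the next remainder inside
   ]0, 1/(b-1)[. *)
Definition in_switch b y := (1 < b * y) && (b * y < (b - 1)^-1).

(** Below the golden base, the digit used outside the switch region is the only one that keeps an
    interior remainder interior. *)
Definition branch_digit b s (st : R * nat) : bool :=
  if in_switch b st.1 then s st.2 else 1 < b * st.1.

(* The second component counts the bits of [s] consumed so far. *)
Fixpoint branch b y s (n : nat) : R * nat :=
  if n is m.+1 then
    let st := branch b y s m in
    (b * st.1 - (branch_digit b s st)%:R, (st.2 + in_switch b st.1)%N)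
  else (y, 0%N).

Definition branch_expansion b y s (n : nat) : bool :=
  branch_digit b s (branch b y s n).

Lemma branch_remainder b y s n :
  (branch b y s n).1 = remainder b y (branch_expansion b y s) n.
Proof. by elim: n => [//|n /= ->]. Qed.

Lemma lt_golden_inv b : 1 < b -> b ^+ 2 < b + 1 -> b < (b - 1)^-1.
Proof.
move=> b1 hb; have b10 : 0 < b - 1 by lra.
by rewrite -div1r ltr_pdivlMr// mulrBr mulr1 -expr2; lra.
Qed.

Lemma branch_itv b y s n : 1 < b -> b ^+ 2 < b + 1 ->
  0 < y < (b - 1)^-1 -> 0 < (branch b y s n).1 < (b - 1)^-1.
Proof.
move=> b1 hb hy; elim: n => [//|n /=].
rewrite /branch_digit /in_switch; set z := (branch b y s n).1 => /andP[z0 zM].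
have M1 : (b - 1) * (b - 1)^-1 = 1 by rewrite divff// gt_eqF//; lra.
have bM := lt_golden_inv b1 hb; set M := (b - 1)^-1 in zM M1 bM *.
have bz0 : 0 < b * z by rewrite mulr_gt0//; lra.
have bzM : b * z < b * M by rewrite ltr_pM2l//; lra.
have [bz1|bz1] := ltP 1 (b * z); have [bzM'|bzM'] := ltP (b * z) M => /=.
all: by [lra|case: (s _) => /=; lra].
Qed.

Lemma branch_expansion_bounded b y s : 1 < b -> b ^+ 2 < b + 1 ->
  0 < y < (b - 1)^-1 -> bounded_expansions b y (branch_expansion b y s).
Proof.
move=> b1 hb hy; exists (b - 1)^-1 => n; rewrite -branch_remainder.
by have /andP[z0 zM] := branch_itv s n b1 hb hy; rewrite gtr0_norm// ltW.
Qed.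

(* Outside the switch region the distance to the nearer endpoint is multiplied
   by [b]; since [b * (b - 1) < 1] it cannot jump over the region. *)
Lemma branch_reaches_switch b y s n : 1 < b -> b ^+ 2 < b + 1 ->
  0 < y < (b - 1)^-1 ->
  exists m, in_switch b (branch b y s m).1 /\ (branch b y s m).2 = (branch b y s n).2.
Proof.
move=> b1 hb hy.
have M1 : (b - 1) * (b - 1)^-1 = 1 by rewrite divff// gt_eqF//; lra.
(* [k] bounds the number of steps left before [b] times the remainder exceeds 1; [high] is the
   mirror image at [1/(b-1)]. *)
have low k : forall n, 1 < b ^+ k.+1 * (branch b y s n).1 ->
    b * (branch b y s n).1 <= 1 ->
    exists m, in_switch b (branch b y s m).1 /\ (branch b y s m).2 = (branch b y s n).2.
  elim: k => [|k IHk] {}n; first by rewrite expr1; lra.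
  move=> hk hlow.
  have hsw : in_switch b (branch b y s n).1 = false.
    by rewrite /in_switch ltNge hlow.
  have e : branch b y s n.+1 = (b * (branch b y s n).1, (branch b y s n).2).
    by rewrite /= /branch_digit hsw ltNge hlow /= subr0 addn0.
  have [h|h] := leP (b * (branch b y s n.+1).1) 1.
    by have [|m [? hm]] := IHk n.+1 _ h; [rewrite e/= mulrA -exprSr|
      exists m; split => //; rewrite hm e].
  exists n.+1; split; last by rewrite e.
  rewrite /in_switch h e /=.
  have : b * (b * (branch b y s n).1) <= b * 1 by rewrite ler_wpM2l//; lra.
  have := lt_golden_inv b1 hb.
  lra.
have high k : forall n, 1 < b ^+ k.+1 * ((b - 1)^-1 - (branch b y s n).1) ->
    (b - 1)^-1 <= b * (branch b y s n).1 ->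
    exists m, in_switch b (branch b y s m).1 /\ (branch b y s m).2 = (branch b y s n).2.
  elim: k => [|k IHk] {}n; first by rewrite expr1; lra.
  move=> hk hhigh.
  have bM := lt_golden_inv b1 hb.
  have hsw : in_switch b (branch b y s n).1 = false.
    by rewrite /in_switch [X in _ && X]ltNge hhigh andbF.
  have e : branch b y s n.+1 = (b * (branch b y s n).1 - 1, (branch b y s n).2).
    rewrite /= /branch_digit hsw addn0; congr (_ - _, _).
    by rewrite (_ : _ < _ = true)//; lra.
  have [h|h] := leP (b - 1)^-1 (b * (branch b y s n.+1).1).
    have [|m [? hm]] := IHk n.+1 _ h; last by exists m; split => //; rewrite hm e.
    rewrite e/= (_ : _ - _ = b * ((b - 1)^-1 - (branch b y s n).1)); last lra.
    by rewrite mulrA -exprSr.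
  exists n.+1; split; last by rewrite e.
  rewrite /in_switch h e /= andbT.
  (* With [z] the old remainder, [b (b z - 1) >= b/(b-1) - b = 1 + 1/(b-1) - b], which exceeds 1. *)
  have : b * (b - 1)^-1 <= b * (b * (branch b y s n).1) by rewrite ler_wpM2l//; lra.
  nra.
have /andP[z0 zM] := branch_itv s n b1 hb hy.
have escape z : 0 < z -> exists k, 1 < b ^+ k.+1 * z.
  move=> {}z0; have [k hk] := exprn_unbounded z^-1 b1; exists k.
  have : 1 < b ^+ k * z by rewrite -ltr_pdivrMr// div1r.
  by rewrite exprS; nra.
have [h1|h1] := leP (b * (branch b y s n).1) 1.
  by have [k hk] := escape _ z0; exact: low hk h1.
have [h2|h2] := leP (b - 1)^-1 (b * (branch b y s n).1).
  have /escape[k hk] : 0 < (b - 1)^-1 - (branch b y s n).1 by lra.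
  exact: high hk h2.
by exists n; rewrite /in_switch h1 h2.
Qed.

(** Equal output digits give equal states. Every bit of [s] is consumed at some visit to the switch
    region, where it is the output digit. *)
Lemma branch_expansion_inj b y : 1 < b -> b ^+ 2 < b + 1 ->
  0 < y < (b - 1)^-1 -> injective (branch_expansion b y).
Proof.
move=> b1 hb hy s t st.
have eq_branch n : branch b y s n = branch b y t n.
  elim: n => [//|n IHn].
  have := congr1 (@^~ n) st; rewrite /branch_expansion => /= ->.
  by rewrite IHn.
have consume j : exists n, in_switch b (branch b y s n).1 /\ (branch b y s n).2 = j.
  elim: j => [|j [n [hn hj]]]; first exact: (branch_reaches_switch s 0 b1 hb hy).
  have [m [hm e]] := branch_reaches_switch s n.+1 b1 hb hy.
  by exists m; split => //; rewrite e /= hn hj addn1.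
apply/funext => j; have [n [hn hj]] := consume j.
have := congr1 (@^~ n) st.
by rewrite /branch_expansion /branch_digit -eq_branch hn hj.
Qed.

(** * The cardinality of the reals *)

(** For [b > 2] the interval [[0, 1/(b-1)]] is shorter than 1, so only one digit can keep the next
    remainder in it. *)
Lemma bounded_expansions_unique b y d d' : 2 < b ->
  bounded_expansions b y d -> bounded_expansions b y d' -> d = d'.
Proof.
move=> b2 hd hd'; have b1 : 1 < b by lra.
have M1 : (b - 1) * (b - 1)^-1 = 1 by rewrite divff// gt_eqF//; lra.
have M0 : 0 < (b - 1)^-1 by rewrite invr_gt0; lra.
have step n : remainder b y d n = remainder b y d' n -> d n = d' n.
  move=> e.
  have := bounded_expansions_remainder n.+1 b1 hd.
  have := bounded_expansions_remainder n.+1 b1 hd'.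
  by rewrite /= e; case: (d n) (d' n) => [] [] //=; nra.
have eq_rem n : remainder b y d n = remainder b y d' n.
  by elim: n => [//|n IHn] /=; rewrite (step n)// IHn.
by apply/funext => n; apply: step.
Qed.

(** The point is the supremum of the partial sums; the geometric tail [b^-n / (b-1)] bounds every
    remainder by [1/(b-1)]. *)
Lemma ex_bounded_expansions b d : 1 < b -> exists y, bounded_expansions b y d.
Proof.
move=> b1.
have M1 : (b - 1) * (b - 1)^-1 = 1 by rewrite divff// gt_eqF//; lra.
have M0 : 0 < (b - 1)^-1 by rewrite invr_gt0; lra.
have bX n : 0 < b ^+ n by rewrite exprn_gt0//; lra.
pose S n : R := \sum_(k < n) (d k)%:R / b ^+ k.+1.
have le_S m n : (m <= n)%N -> S m <= S n <= S m + (b - 1)^-1 * (b ^- m - b ^- n).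
  elim: n => [|n IHn]; first by rewrite leqn0 => /eqP ->; lra.
  rewrite leq_eqVlt => /predU1P[->|/IHn{}IHn]; first lra.
  have : S n.+1 = S n + (d n)%:R / b ^+ n.+1 by rewrite /S big_ord_recr.
  have : (b - 1)^-1 * (b ^- n - b ^- n.+1) = (b ^+ n.+1)^-1.
    rewrite exprS; field; rewrite !gt_eqF//; lra.
  have : 0 < (b ^+ n.+1)^-1 by rewrite invr_gt0.
  by case: (d n) => /=; lra.
pose y := sup (range S).
have ubS m : ubound (range S) (S m + (b - 1)^-1 * b ^- m).
  move=> _ [n _ <-].
  have X0 k : 0 <= b ^- k by rewrite invr_ge0 ltW.
  have X0M k : 0 <= (b - 1)^-1 * b ^- k by rewrite mulr_ge0// ltW.
  have [mn|nm] := leqP m n.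
    by have /andP[_] := le_S _ _ mn; have := X0M n; lra.
  by have /andP[+ _] := le_S _ _ (ltnW nm); have := X0M m; lra.
have rem n : remainder b y d n = b ^+ n * (y - S n).
  elim: n => [|n IHn] /=; first by rewrite expr0 mul1r /S big_ord0 subr0.
  rewrite IHn /S big_ord_recr /= -/(S n) exprS; field.
  by rewrite !gt_eqF//; lra.
exists y, (b - 1)^-1 => n; rewrite rem.
have : S n <= y by apply: ub_le_sup; [exists (S 0%N + (b - 1)^-1 * b ^- 0); exact: ubS|exists n].
have : y <= S n + (b - 1)^-1 * b ^- n.
  by apply: ge_sup => //; exists (S 0%N), 0%N.
move=> h1 h2; rewrite ger0_norm; last by rewrite mulr_ge0 ?subr_ge0// ltW.
by rewrite mulrC -ler_pdivlMr// lerBlDl.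
Qed.

End real_base.

Lemma card_le_inj (T U : Type) (A : set T) (B : set U) (f : T -> U) :
  {in A &, injective f} -> f @` A `<=` B -> A #<= B.
Proof. by move=> finj fAB; apply/card_subP; exists (f @` A) => //; exact: inj_card_eq. Qed.

(** In base 3 a point determines its digits, so choosing a point for each sequence is injective. *)
Lemma card_le_cantor_real (R : realType) : [set: nat -> bool] #<= [set: R].
Proof.
have b1 : (1 : R) < 3 by lra.
have [f hf] := choice (fun d => ex_bounded_expansions d b1).
apply: (@card_le_inj _ _ _ _ f) => // d d' _ _ e.
apply: (@bounded_expansions_unique _ 3 (f d)) => //; first lra.
by rewrite e.
Qed.

(** A real is coded by its Dedekind cut, the rationals being indexed by [pickle]. *)
Lemma card_le_real_cantor (R : realType) : [set: R] #<= [set: nat -> bool].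
Proof.
pose f (x : R) n := if unpickle n is Some r then ratr r < x else false.
have f_lt (x y : R) : x < y -> f x <> f y.
  move=> xy; have [r] := rat_in_itvoo xy; rewrite in_itv/= => /andP[xr ry].
  by move=> /(congr1 (@^~ (pickle r))); rewrite /f pickleK ry ltNge (ltW xr).
apply: (@card_le_inj _ _ _ _ f) => // x y _ _ e.
by have [/f_lt/(_ e)|/f_lt/(_ (esym e))|] := ltgtP x y.
Qed.

(** * Splitting an expansion in base [i p] *)

Lemma expansions_remainder (R : realType) (q x : R[i]) (c : nat -> bool) n : q != 0 ->
  remainder q x c n =
  q ^+ n * (x - series (fun k => (c k)%:R / q ^+ k.+1 : R[i]^o) n).
Proof.
move=> q0; elim: n => [|n IHn]; first by rewrite expr0 mul1r /series/= big_geq// subr0.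
rewrite remainderS IHn seriesSr /= exprS.
set S := series _ _.
have Xn0 : q ^+ n != 0 by rewrite expf_neq0.
by field; rewrite q0 Xn0.
Qed.

(** The error of a partial sum is [r_n / q^n], so bounded remainders give convergence. Conversely, a
    positive excess of [|r_n|] over [1/(|q|-1)] grows at least by the factor [|q|] at each step, too
    fast for a convergent series. *)
Lemma expansionsE (R : realType) (q x : R[i]) : 1 < `|q| ->
  expansions q x = bounded_expansions q x.
Proof.
move=> q1.
have q0 : q != 0 by rewrite -normr_gt0 (lt_trans ltr01).
have X0 n : 0 < `|q| ^+ n by rewrite exprn_gt0// normr_gt0.
apply/seteqP; split => c.
  move=> /cvgrPdist_lt cvg_c; exists ((`|q| - 1)^-1 + 1) => n.
  have M1 : `|q| * (`|q| - 1)^-1 = 1 + (`|q| - 1)^-1.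
    by rewrite -[X in X * _ = _](subrK 1) mulrDl mul1r divff// subr_eq0 gt_eqF.
  have contract k : `|remainder q x c n| - (`|q| - 1)^-1 <=
      (`|remainder q x c (n + k)| - (`|q| - 1)^-1) / `|q| ^+ k.
    elim: k => [|k IHk]; first by rewrite addn0 expr0 divr1.
    rewrite (le_trans IHk)// addnS exprS invfM mulrA ler_pM2r ?invr_gt0//.
    rewrite ler_pdivlMr ?normr_gt0// mulrBl [_^-1 * _]mulrC M1 opprD addrA.
    rewrite lerD2r lerBlDr mulrC -normrM remainderS.
    rewrite -[X in `|X| <= _](subrK (c (n + k)%N)%:R).
    rewrite (le_trans (ler_normD _ _))// lerD2l.
    by case: (c _); rewrite ?normr1 ?normr0.
  have Xn0 : 0 < `|q| ^- n by rewrite invr_gt0.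
  (* Accuracy [|q|^-n] makes the remainder at [n + N] at most [|q|^N], so the excess at [n] is at
     most 1. *)
  have [N _ /(_ (n + N)%N)] := cvg_c _ Xn0.
  rewrite -lerBlDl => /(_ (leq_addl _ _)) hN; apply: (le_trans (contract N)).
  rewrite ler_pdivrMr// mul1r lerBlDr.
  rewrite (expansions_remainder _ _ _ q0) normrM normrX exprD.
  rewrite (@le_trans _ _ (`|q| ^+ N))//; last by rewrite lerDl invr_ge0 subr_ge0 ltW.
  rewrite -mulrA mulrCA -[leRHS]mulr1 ler_pM2l//.
  by rewrite -ler_pdivlMl// mulr1 ltW.
move=> [C hC]; apply/cvgrPdist_lt => e e0.
(* The moduli are transported to [R], where the Archimedean bound [exprn_unbounded] applies. *)
have [Q eQ] : exists Q : R, `|q| = Q%:C by eexists; exact: normc_def.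
have Q1 : 1 < Q by move: q1; rewrite eQ -ltcR.
have /ger0_real/complex_realP[C' eC] : 0 <= C := le_trans (normr_ge0 _) (hC 0%N).
have /gtr0_real/complex_realP[e' ee] := e0.
have e'0 : 0 < e' by move: e0; rewrite ee -ltcR.
have [N hN] := exprn_unbounded (C' / e') Q1.
exists N => // n /= Nn.
rewrite -(ltr_pM2l (X0 n)) -normrX -normrM -expansions_remainder// (le_lt_trans (hC n))//.
rewrite normrX eQ eC ee -rmorphXn -rmorphM ltcR -ltr_pdivrMr// (lt_le_trans hN)//.
by rewrite ler_weXn2l// ltW.
Qed.

(* The flips on alternate digits pass between base -b and base b. *)
Definition interleave (d e : nat -> bool) (k : nat) : bool :=
  (if odd k then d k./2 else e k./2) (+) ~~ odd k./2.

Definition odd_digits (c : nat -> bool) (n : nat) : bool := c n.*2.+1 (+) ~~ odd n.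
Definition even_digits (c : nat -> bool) (n : nat) : bool := c n.*2 (+) ~~ odd n.

Lemma odd_digits_interleave d e : odd_digits (interleave d e) = d.
Proof.
apply/funext => n; rewrite /odd_digits /interleave /= odd_double/= uphalf_double.
by rewrite -addbA addbb addbF.
Qed.

Lemma even_digits_interleave d e : even_digits (interleave d e) = e.
Proof.
apply/funext => n; rewrite /even_digits /interleave odd_double/= doubleK.
by rewrite -addbA addbb addbF.
Qed.

Lemma interleaveK c : interleave (odd_digits c) (even_digits c) = c.
Proof.
apply/funext => n; rewrite /interleave /odd_digits /even_digits.
rewrite -[in RHS](odd_double_half n); case: (odd n) => /=.
  by rewrite -addbA addbb addbF.
by rewrite -addbA addbb addbF.
Qed.

(* The remainders of the series sum_(k odd) b^-k, whose value
   b/(b^2-1) turns digits of base -b into digits of base b. *)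
Definition shift (R : realType) (b : R) (n : nat) : R := (if odd n then 1 else b) / (b ^+ 2 - 1).

(** Two steps multiply by [q^2 = -b] and subtract the imaginary [q c_(2n)] and the real [c_(2n+1)],
    so the two parts evolve independently. *)
Lemma remainder_double (R : realType) (p : R) (x : R[i]) c n (q := 'i%C * p%:C) (b := p ^+ 2) :
  1 < p ->
  complex.Re (remainder q x c n.*2) =
    (-1) ^+ n * (remainder b (complex.Re x + shift b 0) (odd_digits c) n - shift b n) /\
  complex.Im (remainder q x c n.*2) =
    p * (-1) ^+ n * (remainder b (complex.Im x / p + shift b 0) (even_digits c) n - shift b n).
Proof.
move=> hp; have p0 : p != 0 by rewrite gt_eqF//; lra.
have b1 : 1 < b by rewrite exprn_egt1.
have b0 : b ^+ 2 - 1 != 0 by rewrite gt_eqF// subr_gt0 exprn_egt1.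
elim: n => [|n [IHr IHi]].
  by rewrite expr0 /= !addrK mul1r mulr1; split => //; rewrite mulrC divfK.
have -> : remainder q x c n.+1.*2 =
    (- b * complex.Re (remainder q x c n.*2) - (c n.*2.+1)%:R)
    +i* (- b * complex.Im (remainder q x c n.*2) - p * (c n.*2)%:R).
  rewrite doubleS 2!remainderS /q; case: (remainder _ _ _ _) => u v /=.
  by case: (c n.*2) (c n.*2.+1) => [] []; simpc; congr (_ +i* _) => /=; rewrite /b; ring.
rewrite !remainderS [complex.Re _]/= [complex.Im (_ +i* _)]/= IHr IHi.
move: (remainder b _ _ n) (remainder b _ _ n) => r r'.
rewrite {1}/odd_digits {1}/even_digits /shift ![(-1) ^+ n.+1]exprS oddS -signr_odd.
by split; [case: (odd n) (c n.*2.+1) => [] []|case: (odd n) (c n.*2) => [] []] => /=;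
  rewrite ?expr1 ?expr0; field.
Qed.

Lemma normc_real (R : realType) (u : R) : `|u%:C| = `|u|%:C.
Proof. by rewrite normc_def /= expr0n addr0 sqrtr_sqr. Qed.

Lemma normc_imaginary (R : realType) (u : R) : `|'i%C * u%:C| = `|u|%:C.
Proof.
rewrite normrM normc_real normc_def [complex.Re _]/= [complex.Im _]/=.
by rewrite expr0n expr1n add0r sqrtr1 mul1r.
Qed.

Lemma bounded_complex (R : realType) (z : nat -> R[i]) :
  (exists C, forall n, `|z n| <= C) <->
  (exists C, forall n, `|complex.Re (z n)| <= C) /\
  (exists C, forall n, `|complex.Im (z n)| <= C).
Proof.
split=> [[C hC]|[[C hC] [D hD]]].
  have /ger0_real/complex_realP[C' eC] : 0 <= C := le_trans (normr_ge0 _) (hC 0%N).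
  split; exists C' => n; rewrite -lecR -eC (le_trans _ (hC n))// ?normc_ge_Re//.
  (* Multiplication by [-i] reduces the imaginary part to the bound for real parts. *)
  have -> : complex.Im (z n) = complex.Re (- ('i%C * 1%:C) * z n).
    by case: (z n) => u v; simpc.
  by rewrite (le_trans (normc_ge_Re _))// normrM normrN normc_imaginary normr1 mul1r.
exists (C + D)%:C => n; rewrite (complexE (z n)) (le_trans (ler_normD _ _))//.
by rewrite normc_real normc_imaginary -rmorphD lecR lerD.
Qed.

Lemma bounded_affine (R : realType) (u v w : nat -> R) (K L : R) :
  0 < K -> (forall n, `|w n| <= L) -> (forall n, `|u n| = K * `|v n - w n|) ->
  (exists C, forall n, `|u n| <= C) <-> (exists C, forall n, `|v n| <= C).
Proof.
move=> K0 hw huv; split=> -[C hC].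
  exists (C / K + L) => n; rewrite -[v n](subrK (w n)) (le_trans (ler_normD _ _))// lerD//.
  by rewrite ler_pdivlMr// mulrC -huv.
exists (K * (C + L)) => n; rewrite huv ler_pM2l// (le_trans (ler_normB _ _))// lerD//.
Qed.

Lemma bounded_double (K : numDomainType) (q x : K) c :
  (exists C, forall n, `|remainder q x c n.*2| <= C) <->
  bounded_expansions q x c.
Proof.
split=> -[C hC]; last by exists C.
(* [|q| C + 1] covers an odd index, one step after an even one. *)
exists (C + (`|q| * C + 1)) => n.
have C0 : 0 <= C := le_trans (normr_ge0 _) (hC 0%N).
rewrite -(odd_double_half n); case: (odd n) => /=; last first.
  by rewrite add0n (le_trans (hC _))// lerDl addr_ge0// mulr_ge0.
rewrite (le_trans (ler_normB _ _))// ler_wpDl// lerD//.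
  by rewrite normrM ler_wpM2l// hC.
by case: (c _); rewrite /= ?normr1 ?normr0.
Qed.

(* [c k] is the digit of q^-(k+1), so odd indices make up the real part. *)
Lemma expansions_imaginary (R : realType) (p : R) (x : R[i]) c (b := p ^+ 2) : 1 < p ->
  expansions ('i%C * p%:C) x c <->
  bounded_expansions b (complex.Re x + b / (b ^+ 2 - 1)) (odd_digits c) /\
  bounded_expansions b (complex.Im x / p + b / (b ^+ 2 - 1)) (even_digits c).
Proof.
move=> hp; have p0 : 0 < p by lra.
have normq : `|'i%C * p%:C| = p%:C :> R[i].
  by rewrite normc_imaginary gtr0_norm.
rewrite expansionsE; last by rewrite normq (ltcR 1).
rewrite -bounded_double bounded_complex.
have b1 : 1 < b by rewrite exprn_egt1.
have bb1 : 0 < b ^+ 2 - 1 by rewrite subr_gt0 exprn_egt1.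
have shift_le n : `|shift b n| <= b / (b ^+ 2 - 1).
  rewrite /shift ger0_norm; last by rewrite divr_ge0 ?ltW//; case: (odd n); lra.
  by rewrite ler_pM2r ?invr_gt0//; case: (odd n); lra.
have [sgn1 sgnp] : (forall n, `|(-1) ^+ n| = 1 :> R) /\ `|p| = p.
  by split=> [n|]; [rewrite normrX normrN normr1 expr1n|rewrite gtr0_norm].
suff [-> ->] :
  ((exists C, forall n, `|complex.Re (remainder ('i%C * p%:C) x c n.*2)| <= C) <->
    bounded_expansions b (complex.Re x + b / (b ^+ 2 - 1)) (odd_digits c)) /\
  ((exists C, forall n, `|complex.Im (remainder ('i%C * p%:C) x c n.*2)| <= C) <->
    bounded_expansions b (complex.Im x / p + b / (b ^+ 2 - 1)) (even_digits c)) by [].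
split.
- apply: (@bounded_affine _ _ _ (shift b) 1 (b / (b ^+ 2 - 1))) => // n.
  by have [-> _] := remainder_double x c n hp; rewrite normrM sgn1.
- apply: (@bounded_affine _ _ _ (shift b) p (b / (b ^+ 2 - 1))) => // n.
  have [_ ->] := remainder_double x c n hp.
  by rewrite normrM normrM sgn1 sgnp mulr1.
Qed.

Lemma expansions_imaginaryP (R : realType) (p : R) (x : R[i]) d e (b := p ^+ 2) : 1 < p ->
  expansions ('i%C * p%:C) x (interleave d e) <->
  bounded_expansions b (complex.Re x + b / (b ^+ 2 - 1)) d /\
  bounded_expansions b (complex.Im x / p + b / (b ^+ 2 - 1)) e.
Proof.
by move=> hp; rewrite expansions_imaginary// odd_digits_interleave even_digits_interleave.
Qed.

(** * Cardinality of the sets of expansions in base [i p] *)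

Lemma card_expansions_real (R : realType) (p : R) (x : R[i]) : 1 < p ->
  p ^+ 4 < p ^+ 2 + 1 -> J ('i%C * p%:C) x -> ~ vertices p x ->
  expansions ('i%C * p%:C) x #= [set: R].
Proof.
move=> hp hb [c /(expansions_imaginary _ _ hp)[hd he]] nvx.
have p0 : 0 < p by lra.
rewrite (_ : p ^+ 4 = (p ^+ 2) ^+ 2) in hb; last by rewrite -exprM.
apply: Cantor_Bernstein.
  apply: card_le_trans (card_le_cantor_real R).
  exact: (@card_le_inj _ _ _ _ id).
apply: card_le_trans (card_le_real_cantor R) _.
move: hd he hb nvx; rewrite /vertices (_ : p ^+ 4 = (p ^+ 2) ^+ 2); last by rewrite -exprM.
rewrite (_ : p ^+ 3 = p ^+ 2 * p); last by rewrite -exprSr.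
have b1 : 1 < p ^+ 2 by rewrite exprn_egt1.
have inj := expansions_imaginaryP x _ _ hp.
set b := p ^+ 2 in b1 inj *; set y := _ + _ in inj *; set z := _ + _ in inj *.
move=> hd he hb nvx.
have bb1 : 0 < b ^+ 2 - 1 by rewrite subr_gt0 exprn_egt1.
have M1 : (b - 1)^-1 = (b + 1) / (b ^+ 2 - 1) by field; rewrite !gt_eqF//; lra.
have /andP[y0 yM] := bounded_expansions_itv b1 hd.
have /andP[z0 zM] := bounded_expansions_itv b1 he.
(* Branching takes place in a coordinate strictly inside its interval, while the other keeps its
   digits from [c]; if neither is interior, [x] is a vertex. *)
have [yint|yend] := boolP (0 < y < (b - 1)^-1).
  apply: (@card_le_inj _ _ _ _ (fun s => interleave (branch_expansion b y s) (even_digits c))).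
    move=> s t _ _ /(congr1 odd_digits); rewrite !odd_digits_interleave.
    exact: branch_expansion_inj.
  by move=> _ [s _ <-]; apply/inj; split => //; exact: branch_expansion_bounded.
have [zint|zend] := boolP (0 < z < (b - 1)^-1).
  apply: (@card_le_inj _ _ _ _ (fun s => interleave (odd_digits c) (branch_expansion b z s))).
    move=> s t _ _ /(congr1 even_digits); rewrite !even_digits_interleave.
    exact: branch_expansion_inj.
  by move=> _ [s _ <-]; apply/inj; split => //; exact: branch_expansion_bounded.
exfalso; apply: nvx.
have yE : complex.Re x = y - b / (b ^+ 2 - 1) by rewrite addrK.
have zE : complex.Im x = p * (z - b / (b ^+ 2 - 1)).
  by rewrite addrK mulrC divfK// gt_eqF.
have endpoint (t : R) : 0 <= t -> t <= (b - 1)^-1 -> ~~ (0 < t < (b - 1)^-1) ->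
    t - b / (b ^+ 2 - 1) = - b / (b ^+ 2 - 1) \/ t - b / (b ^+ 2 - 1) = 1 / (b ^+ 2 - 1).
  rewrite le_eqVlt => /predU1P[<- _ _|t0]; first by left; rewrite sub0r mulNr.
  rewrite t0 /= -leNgt => tM Mt; right.
  by rewrite (@le_anti _ _ t (b - 1)^-1) ?tM// M1; field; rewrite gt_eqF.
exists (complex.Re x).
  by rewrite yE; exact: endpoint.
exists (complex.Im x); last by case: (x).
rewrite zE; have [->|->] := endpoint _ z0 zM zend; [left|right].
  by rewrite mulrA mulrN [p * b]mulrC.
by rewrite mulrA mulr1.
Qed.

Lemma card_option_nat2 : [set: option nat * option nat] #= [set: nat].
Proof.
apply: eq_card_nat; first exact: countableP.
apply/infiniteP; apply: (@card_le_inj _ _ _ _ (fun n => (Some n, None))) => //.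
by move=> m n _ _ [].
Qed.

Lemma card_expansions_nat (R : realType) (p : R) : 1 < p ->
  p ^+ 4 = p ^+ 2 + 1 -> expansions ('i%C * p%:C) 0 #= [set: nat].
Proof.
move=> hp hb; apply: card_eq_trans card_option_nat2.
pose f (r : option nat * option nat) :=
  interleave (golden_expansion r.1) (golden_expansion r.2).
suff -> : expansions ('i%C * p%:C) 0 = range f.
  apply: inj_card_eq => -[r1 r2] [s1 s2] _ _ e.
  have := congr1 odd_digits e; have := congr1 even_digits e.
  rewrite !odd_digits_interleave !even_digits_interleave /=.
  by move=> /golden_expansion_inj-> /golden_expansion_inj->.
have b1 : 1 < p ^+ 2 by rewrite exprn_egt1.
rewrite (_ : p ^+ 4 = (p ^+ 2) ^+ 2) in hb; last by rewrite -exprM.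
have bE := bounded_expansions_golden b1 hb.
(* The golden equation reads [b^2 - 1 = b], so the shift is 1. *)
have one : p ^+ 2 / ((p ^+ 2) ^+ 2 - 1) = 1.
  by rewrite hb addrK divff// gt_eqF//; lra.
apply/seteqP; split => c.
  move=> /(expansions_imaginary _ _ hp) /=; rewrite one mul0r add0r bE.
  by move=> [[r1 _ e1] [r2 _ e2]]; exists (r1, r2) => //; rewrite /f /= e1 e2 interleaveK.
move=> [r _ <-]; apply/expansions_imaginaryP => //=; rewrite one mul0r add0r bE.
by split; eexists.
Qed.

Theorem theorem4p1 (R : realType) (p : R) (q : R[i])
    (hp : 1 < p) (hq : q = 'i%C * p%:C) :
  (`|q| = (Num.sqrt ((1 + Num.sqrt 5) / 2))%:C ->
     expansions q 0 #= [set: nat]) /\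
  (`|q| < (Num.sqrt ((1 + Num.sqrt 5) / 2))%:C ->
     forall x : R[i], J q x -> ~ vertices p x -> expansions q x #= [set: R]).
Proof.
have p0 : 0 < p by lra.
have normq : `|q| = p%:C.
  by rewrite hq normc_imaginary gtr0_norm.
have s5 : Num.sqrt 5 * Num.sqrt 5 = 5 :> R by rewrite -expr2 sqr_sqrtr.
have s0 : 0 <= Num.sqrt 5 :> R := sqrtr_ge0 _.
set phi := (1 + Num.sqrt 5) / 2.
have phi0 : 0 < phi by rewrite /phi; lra.
have phi2 : phi ^+ 2 = phi + 1 by rewrite /phi expr2; nra.
have p4 : p ^+ 4 = (p ^+ 2) ^+ 2 by rewrite -exprM.
rewrite normq hq; split.
  move=> /complexI pE; apply: card_expansions_nat => //.
  by rewrite p4 pE sqr_sqrtr ?ltW.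
rewrite ltcR => plt x Jx nvx; apply: card_expansions_real => //.
have : p ^+ 2 < phi.
  by rewrite -[ltRHS]sqr_sqrtr ?ltW// ltrXn2r// ?nnegrE ?sqrtr_ge0// ltW.
have : 1 < p ^+ 2 by rewrite exprn_egt1.
rewrite p4; set b := p ^+ 2 => b1 bphi.
(* Since [phi^2 - phi = 1], this product equals [1 + b - b^2]. *)
have : 0 < (phi - b) * (phi + b - 1) by rewrite mulr_gt0//; lra.
by move: phi2; rewrite !expr2; lra.
Qed.
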